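(* Let $t\ge 1$ and $s\ge 2$ be integers. Then $\chi_p(P_{3t}\Diamond_3 C_{4s+2})\le 4$ if $1\le t\le 3$, and $\chi_p(P_{3t}\Diamond_3 C_{4s+2})\le 5$ if $t\ge 4$. Moreover, equality holds for $t\in\{1,2,3\}$.
   Context: A packing $k$-coloring of a graph $H$ is a map $c:V(H)\to\{1,\ldots,k\}$ such that any two distinct vertices $u,v$ with $c(u)=c(v)=i$ satisfy $d_H(u,v)\ge i+1$. The packing chromatic number $\chi_p(H)$ is the least such $k$. $P_m$ denotes the path $v_1\cdots v_m$ and $C_n$ the cycle on $n$ vertices. Path-aligned product: for positive integers $\ell\mid m$ and a connected vertex-transitive graph $G$ containing $P_\ell$ as a subgraph, $P_m\Diamond_\ell G$ is formed from the path $P_m=v_1\cdots v_m$ and $m/\ell$ pairwise disjoint copies of $G$, where for each $1\le i\le m/\ell$ the consecutive path vertices $v_{(i-1)\ell+1},\ldots,v_{i\ell}$ are identified, in order, with the vertices of a path $P_\ell$ (i.e. $\ell$ consecutive cycle vertices when $G$ is a cycle) in the $i$-th copy of $G$. *)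

(* Defs.v *)
From mathcomp Require Import all_boot.

Set Implicit Arguments.
Unset Strict Implicit.
Unset Printing Implicit Defensive.

(* A finite simple graph is a symmetric irreflexive relation e : rel T on a
   finite type T. *)

Section Packing.
Variables (T : finType) (e : rel T).

Definition walk_of_length (u v : T) (n : nat) : bool :=
  [exists w : n.-tuple T, path e u w && (last u w == v)].

(* The least length of a walk from u to v. Meaningful only if connect e u v, in
   which case that length is < #|T|; the distance is infinite otherwise, see
   packing_coloring. *)
Definition dist (u v : T) : nat :=
  find (walk_of_length u v) (iota 0 #|T|).

(* The element j of 'I_k stands for the color j.+1, so that 'I_k stands for
   {1, ..., k}. *)
Definition color k (j : 'I_k) : nat := j.+1.

Definition packing_coloring k (c : {ffun T -> 'I_k}) : bool :=
  [forall u : T, forall v : T,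
     [&& u != v, c u == c v & connect e u v] ==> ((color (c u)).+1 <= dist u v)].

Definition packing_colorable (k : nat) : bool :=
  [exists c : {ffun T -> 'I_k}, packing_coloring c].

Lemma packing_colorable_card : exists k, packing_colorable k.
Proof.
exists #|T|; apply/existsP; exists [ffun v => enum_rank v].
apply/forallP => u; apply/forallP => v; rewrite !ffunE.
by apply/implyP => /and3P[/eqP neq_uv /eqP/enum_rank_inj].
Qed.

Definition packing_chromatic_number : nat := ex_minn packing_colorable_card.

End Packing.

(* P_m, with v_j represented by j - 1. *)
Definition path_graph (m : nat) : rel 'I_m :=
  fun i j => (i.+1 == j) || (j.+1 == i).

(* C_n, for n >= 3. *)
Definition cycle_graph (n : nat) : rel 'I_n :=
  fun i j => (j == ordS i) || (i == ordS j).

Definition is_path_in (T : finType) (e : rel T) (l : nat) (q : 'I_l -> T) : Prop :=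
  injective q /\ (forall a b : 'I_l, path_graph a b -> e (q a) (q b)).

Section PathAlignedProduct.
Variables (m l : nat) (T : finType) (e : rel T).
Variable (q : 'I_(m %/ l) -> 'I_l -> T).

(* When l divides m every vertex of P_m is identified with a vertex of a copy
   of the graph e, so the vertices of the product are the pairs (i, x), where x
   is a vertex of the i-th copy. The path chosen in the i-th copy is q i.
   Counting from 0, v_j is identified with (i, q i a) where j = i * l + a. *)
Definition path_vertex_at (j : 'I_m) (x : 'I_(m %/ l) * T) : bool :=
  [exists a : 'I_l, (j == x.1 * l + a :> nat) && (x.2 == q x.1 a)].

Definition path_aligned_product : rel ('I_(m %/ l) * T) :=
  fun x y =>
    ((x.1 == y.1) && e x.2 y.2) ||
    [exists i : 'I_m, exists j : 'I_m,
       [&& path_graph i j, path_vertex_at i x & path_vertex_at j y]].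

End PathAlignedProduct.

(* Main.v *)
Require Import Defs.
From mathcomp Require Import all_boot.
From mathcomp Require Import zify.

(** The graph is a chain of cycles [C_n], [n = 4s + 2], in which position 2 of
    each cycle is joined to position 0 of the next one.  Four colors suffice
    for every [t]: since the graph is bipartite, color 1 is given to one side of
    the bipartition, and on the other side of each cycle the colors 2 and 3
    alternate except for a single 4.  The positions of the 4s depend only on the
    parity of the index of the cycle, and are far enough apart.
    Three colors are not enough even on a single cycle: any packing 3-coloring
    of a cycle has period 4, which is impossible when [n = 2 (mod 4)]. *)

Section Distance.
Variables (T : finType) (e : rel T).

Lemma walk_dist_le (u : T) (w : seq T) : path e u w -> dist e u (last u w) <= size w.
Proof.
move=> w_path; rewrite leqNgt; apply/negP => lt_w.
have lt_wT : size w < #|T|.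
  by apply: leq_trans lt_w _; rewrite -[leqRHS](size_iota 0) find_size.
have := before_find 0 lt_w; rewrite nth_iota // add0n => /existsP[].
by exists (in_tuple w); rewrite /= w_path eqxx.
Qed.

Lemma connect_walk_dist (u v : T) :
  connect e u v -> exists w, [/\ path e u w, last u w = v & size w = dist e u v].
Proof.
move=> /connectP[p e_p ->]; case/shortenP: e_p => w w_path w_uniq _.
have has_walk : has (walk_of_length e u (last u w)) (iota 0 #|T|).
  apply/hasP; exists (size w); last first.
    by apply/existsP; exists (in_tuple w); rewrite /= w_path eqxx.
  by rewrite mem_iota /= add0n -[(size w).+1]/(size (u :: w)) -(card_uniqP w_uniq) max_card.
have := nth_find 0 has_walk; rewrite nth_iota ?add0n; last first.
  by rewrite -{2}(size_iota 0 #|T|) -has_find.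
by case/existsP => w' /andP[w'_path /eqP last_w']; exists w'; rewrite size_tuple.
Qed.

Lemma lipschitz_le_dist (D : T -> nat) (u v : T) :
    D u = 0 -> (forall x y, e x y -> D y <= (D x).+1) ->
  connect e u v -> D v <= dist e u v.
Proof.
move=> Du0 D_lip /connect_walk_dist[w [w_path <- <-]].
suff: D (last u w) <= D u + size w by rewrite Du0.
elim: w u w_path {Du0} => [|x w IHw] u /=; first by rewrite addn0.
case/andP=> /D_lip le_x /IHw /leq_trans-> //.
by rewrite addnS -addSn leq_add2r.
Qed.

Lemma packing_chromatic_number_le k :
  packing_colorable e k -> packing_chromatic_number e <= k.
Proof. by rewrite /packing_chromatic_number; case: ex_minnP => m _; apply. Qed.

Lemma packing_chromatic_numberP : packing_colorable e (packing_chromatic_number e).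
Proof. by rewrite /packing_chromatic_number; case: ex_minnP. Qed.

End Distance.

Definition cyc_adj n a b : bool :=
  [|| b == a.+1, a == b.+1, (a.+1 == n) && (b == 0) | (b.+1 == n) && (a == 0)].

Definition cyc_dist n a b := minn ((a - b) + (b - a)) (n - ((a - b) + (b - a))).

Lemma val_ordS n (i : 'I_n) : ordS i = (if i.+1 == n then 0 else i.+1) :> nat.
Proof.
rewrite /=; case: eqP => [->|/eqP neq]; first exact: modnn.
by rewrite modn_small // ltn_neqAle neq ltn_ord.
Qed.

Lemma cycle_graphE n (x y : 'I_n) : cycle_graph x y = cyc_adj n x y.
Proof.
rewrite /cycle_graph /cyc_adj -!(inj_eq (@ord_inj n)) !val_ordS.
by have := ltn_ord x; have := ltn_ord y; repeat case: ifP; lia.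
Qed.

(* The path determines a rotation or a reflection of the cycle that carries it
   to the positions 0, 1, 2. *)
Lemma path_in_cycle_position n (q : 'I_3 -> 'I_n) :
    3 <= n -> is_path_in (@cycle_graph n) q ->
  exists f : {ffun 'I_n -> 'I_n},
    [/\ injective f, forall a, f (q a) = a :> nat
      & forall x y, cycle_graph x y -> cyc_adj n (f x) (f y)].
Proof.
move=> n_ge3 [q_inj q_adj].
pose a0 : 'I_3 := inord 0; pose a1 : 'I_3 := inord 1; pose a2 : 'I_3 := inord 2.
have a0E : a0 = 0 :> nat by rewrite inordK.
have a1E : a1 = 1 :> nat by rewrite inordK.
have a2E : a2 = 2 :> nat by rewrite inordK.
have q01 : cyc_adj n (q a0) (q a1).
  by rewrite -cycle_graphE; apply: q_adj; rewrite /path_graph a0E a1E.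
have q12 : cyc_adj n (q a1) (q a2).
  by rewrite -cycle_graphE; apply: q_adj; rewrite /path_graph a1E a2E.
have q02 : q a0 != q a2 :> nat.
  by apply/eqP => /val_inj/q_inj/(congr1 val); rewrite /= a0E a2E.
have q_val (g : 'I_n -> nat) : g (q a0) = 0 -> g (q a1) = 1 -> g (q a2) = 2 ->
    forall a, g (q a) = a.
  move=> g0 g1 g2 a; have := ltn_ord a.
  case E: (val a) => [|[|[|//]]] _.
  - by have -> : a = a0 by apply: val_inj; rewrite /= a0E.
  - by have -> : a = a1 by apply: val_inj; rewrite /= a1E.
  - by have -> : a = a2 by apply: val_inj; rewrite /= a2E.
have [[q0n q1n] q2n] := (ltn_ord (q a0), ltn_ord (q a1), ltn_ord (q a2)).
move: q01 q12; rewrite /cyc_adj => q01 q12.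
pose up := (q a1 == (q a0).+1 :> nat) || ((q a0).+1 == n) && (q a1 == 0 :> nat).
pose g (x : nat) : nat :=
  if up then (if q a0 <= x then x - q a0 else x + n - q a0)
  else (if x <= q a0 then q a0 - x else q a0 + n - x).
have g_lt (x : 'I_n) : g x < n.
  by rewrite /g; have := ltn_ord x; repeat case: ifP; lia.
pose f := [ffun x : 'I_n => Ordinal (g_lt x)].
exists f; split.
- move=> x y /(congr1 val); rewrite !ffunE /= => eq_g; apply: val_inj => /=.
  by move: eq_g (ltn_ord x) (ltn_ord y); rewrite /g; repeat case: ifP; lia.
- apply: (q_val (fun x => f x)); rewrite ffunE /= /g /up;
    by repeat case: ifP; lia.
- move=> x y; rewrite cycle_graphE !ffunE /= /g => adj_xy.
  have [x_lt y_lt] := (ltn_ord x, ltn_ord y).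
  clear -n_ge3 adj_xy x_lt y_lt q0n.
  by case: up; case: ifP => ?; case: ifP => ?; case/or4P: adj_xy => ?;
    rewrite /cyc_adj; lia.
Qed.

(* The distance from position [x] of cycle [i] to position [y] of cycle [j]:
   traversing an intermediate cycle and the edge leaving it takes 3 steps. *)
Definition chain_dist n i x j y : nat :=
  if i == j then cyc_dist n x y
  else if i < j then cyc_dist n x 2 + (3 * (j - i) - 2) + cyc_dist n 0 y
  else cyc_dist n x 0 + (3 * (i - j) - 2) + cyc_dist n 2 y.

Lemma cyc_dist_lipschitz n x y y' :
  x < n -> y < n -> y' < n -> cyc_adj n y y' -> cyc_dist n x y' <= (cyc_dist n x y).+1.
Proof. by rewrite /cyc_dist => x_lt y_lt y'_lt /or4P[] ?; lia. Qed.

Lemma chain_dist_same_cycle n i x j y y' :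
    3 <= n -> x < n -> y < n -> y' < n -> cyc_adj n y y' ->
  chain_dist n i x j y' <= (chain_dist n i x j y).+1.
Proof.
move=> n_ge3 x_lt y_lt y'_lt adj_y.
have lip z : z < n -> cyc_dist n z y' <= (cyc_dist n z y).+1.
  by move=> z_lt; apply: cyc_dist_lipschitz.
rewrite /chain_dist; case: ifP => _; last case: ifP => _; rewrite -?addnS ?leq_add2l;
  by apply: lip => //; apply: leq_trans n_ge3.
Qed.

(* [n = 3] is excluded because there positions 0 and 2 are adjacent. *)
Lemma chain_dist_next_cycle n i x j :
    4 <= n -> x < n ->
  chain_dist n i x j.+1 0 <= (chain_dist n i x j 2).+1 /\
  chain_dist n i x j 2 <= (chain_dist n i x j.+1 0).+1.
Proof.
move=> n_ge4 x_lt; rewrite /chain_dist.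
have -> : cyc_dist n 0 0 = 0 by rewrite /cyc_dist; lia.
have -> : cyc_dist n 2 2 = 0 by rewrite /cyc_dist; lia.
have -> : cyc_dist n 0 2 = 2 by rewrite /cyc_dist; lia.
have -> : cyc_dist n 2 0 = 2 by rewrite /cyc_dist; lia.
by case: (ltngtP i j) => ?; case: (ltngtP i j.+1) => ?; lia.
Qed.

Definition even_cycle_color x : nat :=
  if odd x then 0 else if x == 6 then 3
  else if (x < 6) == (x %% 4 == 0) then 2 else 1.

Definition odd_cycle_color x : nat :=
  if ~~ odd x then 0 else if x == 1 then 3
  else if x %% 4 == 3 then 1 else 2.

(* Shifted by one: the value [k] stands for the color [k + 1]. *)
Definition chain_color i x : nat :=
  if odd i then odd_cycle_color x else even_cycle_color x.

Lemma chain_color_lt4 i x : chain_color i x < 4.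
Proof.
by rewrite /chain_color /odd_cycle_color /even_cycle_color; repeat case: ifP.
Qed.

Lemma chain_dist_sym n i x j y : chain_dist n i x j y = chain_dist n j y i x.
Proof.
have cyc_distC a b : cyc_dist n a b = cyc_dist n b a by rewrite /cyc_dist addnC.
rewrite /chain_dist; case: (ltngtP i j) => _; last exact: cyc_distC.
  by rewrite (cyc_distC x) (cyc_distC y); lia.
by rewrite (cyc_distC x) (cyc_distC y); lia.
Qed.

Lemma chain_color_packing_cycle s i x y :
    2 <= s -> x < y < 4 * s + 2 -> chain_color i x = chain_color i y ->
  (chain_color i x).+2 <= cyc_dist (4 * s + 2) x y.
Proof.
move=> s_ge2 xy_lt; rewrite /chain_color /odd_cycle_color /even_cycle_color /cyc_dist.
case: (odd i).
  by case: ifP => ?; [|case: ifP => ?; [|case: ifP => ?]];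
     (case: ifP => ?; [|case: ifP => ?; [|case: ifP => ?]]) => // _; lia.
by case: ifP => ?; [|case: ifP => ?; [|case: ifP => ?]];
     (case: ifP => ?; [|case: ifP => ?; [|case: ifP => ?]]) => // _; lia.
Qed.

Lemma chain_color_packing_next s i x y :
    2 <= s -> x < 4 * s + 2 -> y < 4 * s + 2 ->
    chain_color i x = chain_color i.+1 y ->
  (chain_color i x).+2 <= cyc_dist (4 * s + 2) x 2 + 1 + cyc_dist (4 * s + 2) 0 y.
Proof.
move=> s_ge2 x_lt y_lt.
rewrite /chain_color /odd_cycle_color /even_cycle_color /cyc_dist /=.
case: (odd i) => /=.
  by case: ifP => ?; [|case: ifP => ?; [|case: ifP => ?]];
     (case: ifP => ?; [|case: ifP => ?; [|case: ifP => ?]]) => // _; lia.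
by case: ifP => ?; [|case: ifP => ?; [|case: ifP => ?]];
     (case: ifP => ?; [|case: ifP => ?; [|case: ifP => ?]]) => // _; lia.
Qed.

Lemma chain_color4_far s i x :
  2 <= s -> chain_color i x = 3 -> 0 < cyc_dist (4 * s + 2) x 2.
Proof.
move=> s_ge2; rewrite /chain_color /odd_cycle_color /even_cycle_color /cyc_dist.
by case: (odd i); (case: ifP => ?; [|case: ifP => ?; [|case: ifP => ?]]) => // _; lia.
Qed.

Lemma chain_color_packing_lt s i x j y :
    2 <= s -> x < 4 * s + 2 -> y < 4 * s + 2 -> i < j ->
    chain_color i x = chain_color j y ->
  (chain_color i x).+2 <= chain_dist (4 * s + 2) i x j y.
Proof.
move=> s_ge2 x_lt y_lt lt_ij eq_col; rewrite /chain_dist ltn_eqF // lt_ij.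
have [j_next|j_far] := eqVneq j i.+1.
  rewrite j_next (_ : 3 * (i.+1 - i) - 2 = 1); last by lia.
  by apply: chain_color_packing_next; rewrite -?j_next.
have := chain_color_lt4 i x; have := @chain_color4_far s i x s_ge2.
lia.
Qed.

Lemma chain_color_packing s i x j y :
    2 <= s -> x < 4 * s + 2 -> y < 4 * s + 2 -> (i, x) != (j, y) ->
    chain_color i x = chain_color j y ->
  (chain_color i x).+2 <= chain_dist (4 * s + 2) i x j y.
Proof.
move=> s_ge2 x_lt y_lt; rewrite xpair_eqE.
case: (ltngtP i j) => [lt_ij|lt_ji|<-] /= neq_xy eq_col.
- exact: chain_color_packing_lt.
- by rewrite eq_col chain_dist_sym; apply: chain_color_packing_lt.
- have [lt_xy|lt_yx|eq_xy] := ltngtP x y; last by rewrite eq_xy eqxx in neq_xy.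
    by rewrite /chain_dist eqxx; apply: chain_color_packing_cycle; rewrite ?lt_xy.
  rewrite eq_col chain_dist_sym /chain_dist eqxx.
  by apply: chain_color_packing_cycle; rewrite ?lt_yx.
Qed.

(* Two consecutive vertices cannot both avoid color 1, so the colors read
   1 2 1 3 around the cycle. *)
Lemma packing3_period4 (c : nat -> nat) :
    (forall i, 0 < c i <= 3) -> (forall i, c i <> c i.+1) ->
    (forall i, c i = c i.+2 -> c i = 1) -> (forall i, c i = c i.+3 -> c i <> 3) ->
  forall i, c i.+4.+4 = c i.+4.
Proof.
move=> c_rng c1 c2 c3.
have one i : (c i.+2 = 1) \/ (c i.+3 = 1).
  have [/eqP c23|/eqP c23] := boolP (c i.+2 == 2).
    move: (c_rng i) (c_rng i.+1) (c_rng i.+3) (c1 i) (c1 i.+1) (c1 i.+2).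
    by move: (c2 i) (c2 i.+1) (c3 i); lia.
  move: (c_rng i.+2) (c_rng i.+3) (c_rng i.+4) (c_rng i.+4.+1) (c1 i.+2) (c1 i.+3) (c1 i.+4).
  by move: (c2 i.+2) (c2 i.+3) (c3 i.+2); lia.
move=> i; move: (one i.+2) (one i.+3) (one i.+4) (one i.+4.+1).
move: (c_rng i.+4) (c_rng i.+4.+2) (c_rng i.+4.+4) (c2 i.+4) (c2 i.+4.+2).
by move: (c1 i.+4) (c1 i.+4.+1) (c1 i.+4.+2) (c1 i.+4.+3); lia.
Qed.

Section Chain.
Variables (t s : nat) (s_ge2 : 2 <= s).
Variable (q : 'I_((3 * t) %/ 3) -> 'I_3 -> 'I_(4 * s + 2)).
Hypothesis q_path : forall i, is_path_in (@cycle_graph (4 * s + 2)) (q i).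

Local Notation n := (4 * s + 2).
Local Notation vertex := ('I_((3 * t) %/ 3) * 'I_n)%type.
Local Notation prod_graph := (@path_aligned_product (3 * t) 3 _ (@cycle_graph n) q).

Lemma chain_packing_colorable4 : packing_colorable prod_graph 4.
Proof.
have n_ge4 : 4 <= n by lia.
have n_ge3 : 3 <= n by lia.
have [f f_pos] := fin_all_exists (fun i => @path_in_cycle_position n _ n_ge3 (q_path i)).
pose F (v : vertex) : nat := f v.1 v.2.
have F_lt v : F v < n by apply: ltn_ord.
have D_lip (u v w : vertex) : prod_graph v w ->
    chain_dist n u.1 (F u) w.1 (F w) <= (chain_dist n u.1 (F u) v.1 (F v)).+1.
  case: v w => [i x] [j y] /orP[/andP[/= /eqP <- adj_xy]|].
    by apply: chain_dist_same_cycle => //; rewrite /F; case: (f_pos i) => _ _; apply.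
  case/existsP=> a /existsP[b /and3P[adj_ab]].
  case/existsP=> a' /andP[/= /eqP aE /eqP ->] /existsP[b' /andP[/= /eqP bE /eqP ->]].
  have Fv : F (i, q i a') = a' by rewrite /F; case: (f_pos i) => _ ->.
  have Fw : F (j, q j b') = b' by rewrite /F; case: (f_pos j) => _ ->.
  have [a'_lt b'_lt] := (ltn_ord a', ltn_ord b').
  move: adj_ab; rewrite /path_graph Fv Fw aE bE => adj_ab.
  have [eq_ij|neq_ij] := eqVneq (i : nat) (j : nat).
    rewrite -eq_ij; apply: chain_dist_same_cycle; rewrite -?Fv -?Fw //.
    by rewrite Fv Fw /cyc_adj; lia.
  case/orP: adj_ab => /eqP adj_ab.
    have [-> -> ->] : [/\ a' = 2 :> nat, b' = 0 :> nat & j = i.+1 :> nat] by split; lia.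
    by case: (@chain_dist_next_cycle n u.1 (F u) i).
  have [-> -> ->] : [/\ a' = 0 :> nat, b' = 2 :> nat & i = j.+1 :> nat] by split; lia.
  by case: (@chain_dist_next_cycle n u.1 (F u) j).
apply/existsP; exists [ffun v : vertex => inord (chain_color v.1 (F v))].
apply/forallP => u; apply/forallP => v; apply/implyP => /and3P[neq_uv].
rewrite !ffunE -val_eqE /= /color !inordK ?chain_color_lt4 // => /eqP eq_col con_uv.
apply: leq_trans (_ : chain_dist n u.1 (F u) v.1 (F v) <= _).
  apply: chain_color_packing => //; apply: contra neq_uv.
  rewrite !xpair_eqE => /andP[/eqP/val_inj eq1 /eqP/val_inj].
  rewrite -eq1; case: (f_pos u.1) => f_inj _ _ /f_inj eq2.
  by rewrite [u]surjective_pairing [v]surjective_pairing eq1 eq2.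
apply: (@lipschitz_le_dist _ _ (fun v : vertex => chain_dist n u.1 (F u) v.1 (F v))) => //.
- by rewrite /chain_dist eqxx /cyc_dist subnn min0n.
- by move=> x y; apply: D_lip.
Qed.

Lemma chain_packing_colorable_gt3 k : 0 < t -> packing_colorable prod_graph k -> 3 < k.
Proof.
move=> t_gt0 /existsP[c /forallP c_packing]; rewrite ltnNge; apply/negP => k_le3.
have n_gt0 : 0 < n by lia.
have i0_lt : 0 < (3 * t) %/ 3 by rewrite mulKn.
pose v (j : nat) : vertex :=
  (Ordinal i0_lt, Ordinal (ltn_pmod j n_gt0)).
have v_eq j j' : j = j' %[mod n] -> v j = v j'.
  by move=> eq_jj'; congr pair; apply: val_inj.
have v_adj j : prod_graph (v j) (v j.+1).
  apply/orP; left; apply/andP; split=> //; apply/orP; left; apply/eqP/val_inj => /=.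
  by rewrite -[in LHS]addn1 -[in RHS]addn1 modnDml.
have v_neq j d : 0 < d < n -> v j != v (j + d).
  move=> /andP[d_gt0 d_lt]; apply/eqP => -[] /eqP.
  rewrite -{1}[j]addn0 eqn_modDl mod0n modn_small //; lia.
pose col j := color (c (v j)).
have col_near j d w : path prod_graph (v j) w -> last (v j) w = v (j + d) ->
    size w = d -> 0 < d <= 3 -> col j = col (j + d) -> (col j).+1 <= d.
  move=> w_path w_last w_size d_rng [/val_inj eq_c].
  apply: leq_trans (_ : dist prod_graph (v j) (v (j + d)) <= d); last first.
    by rewrite -w_last -w_size walk_dist_le.
  have /forallP/(_ (v (j + d)))/implyP := c_packing (v j); apply.
  rewrite v_neq; last by lia.
  by rewrite eq_c eqxx; apply/connectP; exists w.
have col_rng j : 0 < col j <= 3.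
  by rewrite /col /color; have := ltn_ord (c (v j)); lia.
have col1 j : col j <> col j.+1.
  move=> eq_col; have := @col_near j 1 [:: v j.+1].
  rewrite /= v_adj (addn1 j) => /(_ isT erefl erefl isT eq_col).
  by have := col_rng j; lia.
have col2 j : col j = col j.+2 -> col j = 1.
  move=> eq_col; have := @col_near j 2 [:: v j.+1; v j.+2].
  rewrite /= !v_adj (addn2 j) => /(_ isT erefl erefl isT eq_col).
  by have := col_rng j; lia.
have col3 j : col j = col j.+3 -> col j <> 3.
  move=> eq_col; have := @col_near j 3 [:: v j.+1; v j.+2; v j.+3].
  rewrite /= !v_adj (addn3 j) => /(_ isT erefl erefl isT eq_col).
  by have := col_rng j; lia.
have col_period m j : col (4 * m + j.+4) = col j.+4.
  elim: m => [|m IHm]; first by [].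
  have := @packing3_period4 col col_rng col1 col2 col3 (4 * m + j).
  by rewrite (_ : 4 * m.+1 + j.+4 = (4 * m + j).+4.+4); [rewrite -IHm !addnS|lia].
have col_shift2 j : col j.+4.+2 = col j.+4.
  rewrite -(col_period s) /col; congr (color (c _)); apply: v_eq.
  by rewrite (_ : 4 * s + j.+4.+2 = n + j.+4) ?modnDl //; lia.
have := col1 4; have := col2 4; have := col2 5; rewrite !col_shift2; lia.
Qed.

End Chain.

Theorem theorem9 (t s : nat) (t_ge1 : 1 <= t) (s_ge2 : 2 <= s)
    (q : 'I_((3 * t) %/ 3) -> 'I_3 -> 'I_(4 * s + 2))
    (q_path : forall i, is_path_in (@cycle_graph (4 * s + 2)) (q i)) :
  let chi := packing_chromatic_number
               (@path_aligned_product (3 * t) 3 _ (@cycle_graph (4 * s + 2)) q) in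
  (1 <= t <= 3 -> chi <= 4) /\
  (4 <= t -> chi <= 5) /\
  (t \in [:: 1; 2; 3] -> chi = 4).
Proof.
move=> chi.
have chi_le4 : chi <= 4.
  exact/packing_chromatic_number_le/chain_packing_colorable4.
have chi_gt3 : 3 < chi.
  exact: chain_packing_colorable_gt3 s_ge2 _ _ t_ge1 (packing_chromatic_numberP _ _).
by split=> //; split=> _; [apply: leqW | apply/eqP; rewrite eqn_leq chi_le4].
Qed.
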